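(* Let $2\le k<m$ and let $\mathcal P_m$ be a polar code of length $2^m$ with generating monomial set $$P_m=\{\mathbf 1,x_0,x_1,\dots,x_{m-1}\}\cup S(x_0,\dots,x_{k-1}),$$ where $S(x_0,\dots,x_{k-1})$ is a set of monomials of degree greater than $1$ in the variables $x_0,\dots,x_{k-1}$ that contains $x_0x_{k-1}$ (and thus contains $x_0x_i$ for $1\le i\le k-2$). Let $\mathcal P_k$ be the subcode of $\mathcal P_m$ (of length $2^m$) with generating monomial set $P_k=P_m\setminus\{x_k,\dots,x_{m-1}\}$, and let $K$ be its dimension. Let $\bar{\mathcal P}_k$ be the polar code of length $2^k$ with the same generating monomial set $P_k$, regarded as monomials in $x_0,\dots,x_{k-1}$. Then $\mathrm{Aut}\,\mathcal P_m$ is a subgroup of $\mathrm{Aut}\,\mathcal P_k$, and $$\mathrm{Aut}\,\mathcal P_m\cong(\mathbb Z_2)^{(m-k)K}:\bigl(\mathrm{GL}(m-k,2)\times T\bigr),\qquad\text{where } T\cong\mathrm{Aut}\,\bar{\mathcal P}_k .$$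
   Context: Monomials and evaluation. A monomial in $x_0,\dots,x_{n-1}$ is a squarefree product $x_0^{v_0}\cdots x_{n-1}^{v_{n-1}}$, $v\in\mathbb F_2^n$, of degree the Hamming weight of $v$; the degree $0$ monomial is $\mathbf 1$. A monomial is identified with its evaluation vector in $\mathbb F_2^{2^n}$: $\mathbf 1$ is the all-ones vector, $x_i$ is the vector whose entry in position $j\in\{0,\dots,2^n-1\}$ is $1$ if and only if the $i$-th binary digit of $j$ ($i=0$ least significant) is $0$ (so $x_0=1010\cdots$, $x_1=11001100\cdots$, and $x_{n-1}$ is $2^{n-1}$ ones followed by $2^{n-1}$ zeros), and products of monomials are entrywise products. A monomial code of length $2^n$ is the $\mathbb F_2$-span of the evaluation vectors of a set $M$ of monomials, called its generating monomial set. It is decreasing if $g\in M$, $f$ a monomial and $f\preccurlyeq g$ imply $f\in M$, where for equal degrees $x_{i_1}\cdots x_{i_s}\preccurlyeq x_{j_1}\cdots x_{j_s}$ (indices in increasing order) iff $i_k\le j_k$ for all $k$, and in general $f\preccurlyeq g$ iff there is a divisor $g'$ of $g$ with $\deg g'=\deg f$ and $f\preccurlyeq g'$. Polar codes of length $N=2^n$ are the codes $\{uT_N: u\in\mathbb F_2^N,\ u_i=0 \text{ for } i\notin\mathcal I\}$, where $T_N=\begin{pmatrix}1&0\\1&1\end{pmatrix}^{\otimes n}$ and $\mathcal I\subseteq\{0,\dots,N-1\}$ is the information set. The rows of $T_N$ are evaluation vectors of monomials, so these are monomial codes; polar codes are always taken to be decreasing monomial codes. Automorphisms. $\mathrm S_N$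 is the symmetric group of degree $N$; it acts on $\mathbb F_2^N$ by permuting coordinates. An automorphism of a code $\mathcal C\subseteq\mathbb F_2^N$ is a permutation $\tau\in\mathrm S_N$ with $\tau(c)\in\mathcal C$ for all $c\in\mathcal C$; $\mathrm{Aut}\,\mathcal C$ is the group of all automorphisms. The notation $A:B$ denotes a semidirect product (split extension) with normal subgroup $A$ and complement $B$. *)

(* Defs.v *)
From HB Require Import structures.
From mathcomp Require Import all_boot all_order all_algebra all_fingroup.
From mathcomp Require Import mxtens.

Set Implicit Arguments.
Unset Strict Implicit.
Unset Printing Implicit Defensive.

Import GroupScope GRing.Theory.
Local Open Scope ring_scope.

(* A squarefree monomial x^v in x_0, ..., x_{n-1} is the set of the indices of
   its variables: set0 is the monomial 1, #|f| is the degree of f, and \subset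
   is divisibility. *)
Definition monomial (n : nat) := {set 'I_n}.

Definition digit (i j : nat) : bool := odd (j %/ 2 ^ i).

(* The convention is x_i = 1 where the i-th binary digit is 0. *)
Definition eval_var (n : nat) (i : 'I_n) : 'rV['F_2]_(2 ^ n) :=
  \row_j (~~ digit i j)%:R.

Definition eval (n : nat) (f : monomial n) : 'rV['F_2]_(2 ^ n) :=
  \row_j \prod_(i in f) eval_var i 0 j.

Definition monomial_code (n : nat) (M : {set monomial n}) :
    {vspace 'rV['F_2]_(2 ^ n)} :=
  <<[seq eval f | f <- enum M]>>%VS.

(* enum f lists the indices of f in increasing order; all2 also forces the
   degrees to be equal. *)
Definition eqdeg_le (n : nat) (f g : monomial n) : bool :=
  all2 (fun i j : 'I_n => (i <= j)%N) (enum f) (enum g).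

Definition mon_le (n : nat) (f g : monomial n) : bool :=
  [exists g' : monomial n,
     [&& g' \subset g, #|g'| == #|f| & eqdeg_le f g']].

Definition decreasing (n : nat) (M : {set monomial n}) : Prop :=
  forall f g : monomial n, g \in M -> mon_le f g -> f \in M.

Definition polar_kernel : 'M['F_2]_2 :=
  \matrix_(i < 2, j < 2) (j <= i)%N%:R.

Definition polar_transform (n : nat) : 'M['F_2]_(2 ^ n) := polar_kernel ^t n.

Definition polar_code_of (n : nat) (I : {set 'I_(2 ^ n)})
    (C : {vspace 'rV['F_2]_(2 ^ n)}) : Prop :=
  forall c : 'rV['F_2]_(2 ^ n),
    c \in C <->
    exists2 u : 'rV['F_2]_(2 ^ n),
      forall i, i \notin I -> u 0 i = 0 & c = u *m polar_transform n.

(* Polar codes are always taken to be decreasing monomial codes. *)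
Definition polar_code (n : nat) (M : {set monomial n})
    (C : {vspace 'rV['F_2]_(2 ^ n)}) : Prop :=
  [/\ exists I : {set 'I_(2 ^ n)}, polar_code_of I C,
      C = monomial_code M
    & decreasing M].

Definition code_aut (N : nat) (C : {vspace 'rV['F_2]_N}) : {set 'S_N} :=
  [set s : 'S_N | [forall c : 'rV['F_2]_N, (c \in C) ==> (col_perm s c \in C)]].

Lemma code_aut_group_set N (C : {vspace 'rV['F_2]_N}) : group_set (code_aut C).
Proof.
apply/group_setP; split.
  by rewrite inE; apply/forallP=> c; apply/implyP; rewrite col_perm1.
move=> s t; rewrite !inE => /forallP Hs /forallP Ht.
apply/forallP=> c; apply/implyP=> Hc; rewrite col_permM.
by apply: (implyP (Hs _)); apply: (implyP (Ht _)).
Qed.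

Canonical code_aut_group N (C : {vspace 'rV['F_2]_N}) :=
  Group (code_aut_group_set C).

Definition gens_m (m : nat) (S : {set monomial m}) : {set monomial m} :=
  set0 |: ([set [set i] | i : 'I_m] :|: S).

Definition gens_k (m k : nat) (S : {set monomial m}) : {set monomial m} :=
  gens_m S :\: [set [set i] | i : 'I_m & (k <= i)%N].

Definition widen_mon (k m : nat) (lekm : (k <= m)%N) (f : monomial k) :
    monomial m :=
  [set widen_ord lekm i | i in f].

(* The monomials of M that involve only x_0, ..., x_{k-1}, regarded as
   monomials in these k variables. *)
Definition regard (k m : nat) (lekm : (k <= m)%N) (M : {set monomial m}) :
    {set monomial k} :=
  [set f : monomial k | widen_mon lekm f \in M].

(* Main.v *)
Require Import Defs.
From HB Require Import structures.
From mathcomp Require Import all_boot all_order all_algebra all_fingroup.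

Set Implicit Arguments.
Unset Strict Implicit.
Unset Printing Implicit Defensive.

Import GroupScope GRing.Theory.
Local Open Scope ring_scope.

(** Split a position j of length 2 ^ m into its k low digits a and the vector b
    of the values at j of x_k, ..., x_(m-1), so that positions are pairs (a, b)
    with b in F_2 ^ (m - k).  The words of the large code are the functions
    f(a) + b.lam with f in the short code of length 2 ^ k and lam in
    F_2 ^ (m - k); the words of the subcode are those with lam = 0.

    Automorphisms of the large code preserve the subcode because the latter is
    spanned by the words of the former whose weight is not half of the length.
    Indeed, if some coordinate lam_i is nonzero, then flipping b_i exchanges the
    zeros and the ones of the word, so an unbalanced word lies in the subcode
    ([unbalanced_low]).  Conversely 1 and the monomials of degree at least 2 are
    unbalanced, and so is x_i + x_i x_l, hence x_i is a sum of two unbalanced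
    words as soon as some x_i x_l is in S.  This is what x_0 x_(k-1) in S
    provides, the code being decreasing ([low_var_partner]).  As a permutation
    preserves weights, [aut_sub] follows.

    Let now s be an automorphism of the large code.  Since it preserves the
    subcode and the short code separates the points a, the low part of s(a, b)
    is t(a) for an automorphism t of the short code.  The coordinates of the
    high part are words of the large code, hence s(a, b) = (t(a), b u + W_a) for
    an invertible u and a matrix W whose columns lie in the short code
    ([aut_skew]).  All such skew permutations are automorphisms, and they
    multiply by the rule of [skewM].  Therefore the permutations (1, W, 1) form
    a normal elementary abelian subgroup with one copy of the short code for
    each of the m - k columns, and its complement consists of the (t, 0, u),
    the direct product of GL(m - k, 2) with the automorphism group of the short
    code ([skew_aut_structure]). *)

Lemma code_autP N (C : {vspace 'rV['F_2]_N}) (s : 'S_N) :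
  reflect (forall c, c \in C -> col_perm s c \in C) (s \in code_aut C).
Proof.
rewrite inE; apply: (iffP forallP) => sC c; first exact: (implyP (sC c)).
by apply/implyP; apply: sC.
Qed.

(** * Permutations of a product with a vector space *)

(** Coordinates (lo, hi) identify the positions with pairs of a point of a base
    and a vector; a base point a0 is needed because over an empty base the
    linear part of a skew permutation is not determined. *)
Section SkewProduct.

Context (N N' n' : nat) (a0 : 'I_N').
Local Notation n := n'.+1.
Context (lo : 'I_N -> 'I_N') (hi : 'I_N -> 'rV['F_2]_n).
Context (pos : 'I_N' -> 'rV['F_2]_n -> 'I_N).
Hypothesis lo_pos : forall a b, lo (pos a b) = a.
Hypothesis hi_pos : forall a b, hi (pos a b) = b.
Hypothesis posK : forall j, pos (lo j) (hi j) = j.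

Implicit Types (t : 'S_N') (W : 'M['F_2]_(N', n)) (u : {'GL_n['F_2]}).
Implicit Types (f : 'rV['F_2]_N') (lam : 'cV['F_2]_n).

Lemma pos_ext j j' : lo j = lo j' -> hi j = hi j' -> j = j'.
Proof. by move=> eq_lo eq_hi; rewrite -(posK j) eq_lo eq_hi posK. Qed.

Definition skew_fun t W u (j : 'I_N) : 'I_N :=
  pos (t (lo j)) (hi j *m GLval u + row (lo j) W).

Lemma skew_inj t W u : injective (skew_fun t W u).
Proof.
move=> j j' eq_jj'.
have eq_lo : lo j = lo j'.
  have := congr1 lo eq_jj'; rewrite !lo_pos; exact: perm_inj.
apply: pos_ext => //.
have /(congr1 hi) := eq_jj'; rewrite !hi_pos eq_lo => /addIr.
by apply: can_inj (mulmxK (GL_unitmx u)) _ _.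
Qed.

Definition skew t W u : 'S_N := perm (@skew_inj t W u).

Lemma lo_skew t W u j : lo (skew t W u j) = t (lo j).
Proof. by rewrite permE lo_pos. Qed.

Lemma hi_skew t W u j :
  hi (skew t W u j) = hi j *m GLval u + row (lo j) W.
Proof. by rewrite permE hi_pos. Qed.

(** The product of permutations applies its left factor first, so linear parts,
    which act on row vectors from the right, multiply in the same order. *)
Lemma skewM t W u t' W' u' :
  (skew t W u * skew t' W' u')%g
  = skew (t * t')%g (W *m GLval u' + row_perm t W') (u * u')%g.
Proof.
apply/permP=> j; rewrite permM; apply: pos_ext.
  by rewrite !lo_skew permM.
rewrite !hi_skew lo_skew GL_ME mulmxDl -mulmxA -addrA; congr (_ + _).
by apply/rowP=> i; rewrite mxE -row_mul !mxE.
Qed.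

Lemma skew_eq t W u t' W' u' :
  skew t W u = skew t' W' u' -> [/\ t = t', W = W' & u = u'].
Proof.
move=> eq_s; have eqW : W = W'.
  apply/row_matrixP=> a; have := hi_skew t W u (pos a 0).
  by rewrite eq_s hi_skew hi_pos lo_pos !mul0mx !add0r.
split=> //.
  by apply/permP=> a; rewrite -(lo_pos a 0) -(lo_skew t W u) eq_s lo_skew.
apply: val_inj; apply/row_matrixP=> i.
have := hi_skew t W u (pos a0 (delta_mx 0 i)).
by rewrite eq_s hi_skew hi_pos lo_pos eqW => /addIr; rewrite -!rowE.
Qed.

Lemma skew1 : skew 1%g 0 1%g = 1%g.
Proof.
apply/permP=> j; rewrite perm1; apply: pos_ext; first by rewrite lo_skew perm1.
by rewrite hi_skew mulmx1 row0 addr0.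
Qed.

Definition word f lam : 'rV['F_2]_N :=
  \row_j (f 0 (lo j) + (hi j *m lam) 0 0).

Lemma wordE f lam j : word f lam 0 j = f 0 (lo j) + (hi j *m lam) 0 0.
Proof. by rewrite mxE. Qed.

Definition cols_in (C : {vspace 'rV['F_2]_N'}) W :=
  forall i, (col i W)^T \in C.

(** The hypothesis aut_base holds as soon as automorphisms of D preserve the
    subcode of the words with lam = 0. *)
Context (C : {vspace 'rV['F_2]_N'}) (D : {vspace 'rV['F_2]_N}).
Hypothesis DP : forall c,
  c \in D <-> exists2 f, f \in C & exists lam, c = word f lam.
Hypothesis C_separates :
  forall a a', (forall f, f \in C -> f 0 a = f 0 a') -> a = a'.
Hypothesis aut_base : forall s, s \in code_aut D ->
  forall f, f \in C -> exists2 f', f' \in C &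
    forall j, f 0 (lo (s j)) = f' 0 (lo j).

Lemma skew_aut t W u :
  t \in code_aut C -> cols_in C W -> skew t W u \in code_aut D.
Proof.
move=> /code_autP tC WC; apply/code_autP=> _ /DP[f fC [lam ->]]; apply/DP.
exists (col_perm t f + (W *m lam)^T).
  rewrite memvD ?tC // trmx_mul mulmx_sum_row memv_suml // => i _.
  by rewrite -tr_col memvZ.
exists (GLval u *m lam); apply/rowP=> j.
rewrite [LHS]mxE !wordE lo_skew hi_skew mulmxDl -mulmxA -row_mul.
by rewrite mxE addrCA [RHS]addrC; congr (_ + _); rewrite !mxE.
Qed.

(** Since C separates the points of the base, s permutes the fibers of lo; and
    since each coordinate of hi is a word of D, so is its composite with s,
    which makes s affine on each fiber with a linear part common to all. *)
Lemma aut_skew s : s \in code_aut D ->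
  exists t W u, [/\ t \in code_aut C, cols_in C W & s = skew t W u].
Proof.
move=> sD; have /code_autP s_stab := sD.
have lo_s j j' : lo j = lo j' -> lo (s j) = lo (s j').
  move=> eq_lo; apply: C_separates => f /(aut_base sD)[f' _ sf'].
  by rewrite !sf' eq_lo.
pose tau a := lo (s (pos a 0)).
have lo_tau j : lo (s j) = tau (lo j) by apply: lo_s; rewrite lo_pos.
have tau_inj : injective tau.
  have tauK : cancel (fun a => lo (s^-1%g (pos a 0))) tau.
    by move=> a; rewrite -lo_tau permKV lo_pos.
  exact: can_inj (canF_sym tauK).
pose t := perm tau_inj.
pose affine_at i f := exists lam, forall j,
  hi (s j) 0 i = f 0 (lo j) + (hi j *m lam) 0 0.
have [f' f'C sf'] :
    exists2 f', forall i, f' i \in C & forall i, affine_at i (f' i).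
  apply: (@fin_all_exists2 _ _ (fun _ f => is_true (f \in C)) affine_at) => i.
  (* The i-th coordinate of hi is the word with f = 0 and lam = e_i. *)
  have /s_stab/DP[f' f'C [lam Ef]] : word 0 (delta_mx i 0) \in D.
    by apply/DP; exists 0; [apply: mem0v | exists (delta_mx i 0)].
  exists f' => //; exists lam => j; have /rowP/(_ j) := Ef.
  by rewrite mxE !wordE -colE [col _ _ _ _]mxE [X in X + _ = _]mxE add0r.
have [lam slam] := fin_all_exists sf'.
pose W : 'M['F_2]_(N', n) := \matrix_(a, i) f' i 0 a.
pose M : 'M['F_2]_n := \matrix_(l, i) lam i l 0.
have hi_s j : hi (s j) = hi j *m M + row (lo j) W.
  apply/rowP=> i; rewrite slam addrC !mxE; congr (_ + _).
  by apply: eq_bigr => l _; rewrite !mxE.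
have uM : M \in unitmx.
  (* A kernel vector v would give (a0, v) and (a0, 0) the same image. *)
  rewrite -row_free_unit; apply: inj_row_free => v vM0.
  have /perm_inj/(congr1 hi) : s (pos a0 v) = s (pos a0 0).
    by apply: pos_ext; rewrite ?lo_tau ?hi_s ?lo_pos ?hi_pos // vM0 mul0mx.
  by rewrite !hi_pos.
exists t, W, (FinRing.unit _ uM : {'GL_n['F_2]}); split.
- apply/code_autP=> f fC; have [f1 f1C sf1] := aut_base sD fC.
  suff -> : col_perm t f = f1 by [].
  by apply/rowP=> a; rewrite mxE permE sf1 lo_pos.
- move=> i; suff -> : (col i W)^T = f' i by [].
  by apply/rowP=> a; rewrite !mxE.
apply/permP=> j; apply: pos_ext; first by rewrite lo_skew permE.
by rewrite hi_skew hi_s.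
Qed.

(** A basis of C parametrizes the translation parts by matrices; so they form a
    group that is elementary abelian of rank n times the dimension of C. *)
Definition fiber_shift (U : 'M['F_2]_(n, \dim C)) : 'M['F_2]_(N', n) :=
  (U *m \matrix_l (vbasis C)`_l)^T.

Lemma fiber_shift_in U : cols_in C (fiber_shift U).
Proof.
move=> i; rewrite /fiber_shift -tr_row trmxK row_mul mulmx_sum_row.
apply: memv_suml => l _.
by rewrite rowK memvZ // vbasis_mem // mem_nth // size_tuple.
Qed.

Lemma fiber_shift_onto W : cols_in C W -> exists U, W = fiber_shift U.
Proof.
move=> WC; exists (\matrix_(i, l) coord (vbasis C) l (col i W)^T).
apply: trmx_inj; rewrite trmxK; apply/row_matrixP=> i; rewrite -tr_col.
rewrite [LHS](coord_vbasis (WC i)) row_mul mulmx_sum_row.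
by apply: eq_bigr => l _; rewrite rowK !mxE.
Qed.

Lemma fiber_shift_inj : injective fiber_shift.
Proof.
move=> U U' /trmx_inj eqU; apply/eqP; rewrite -subr_eq0; apply/eqP.
apply/matrixP=> i l; rewrite [RHS]mxE.
have dep : \sum_l (U - U') i l *: (vbasis C)`_l = 0.
  transitivity (row i ((U - U') *m \matrix_l (vbasis C)`_l)).
    rewrite row_mul mulmx_sum_row; apply: eq_bigr => l' _.
    by rewrite rowK [row _ _ _ _]mxE.
  by rewrite mulmxBl eqU subrr row0.
by have /freeP/(_ _ dep) := basis_free (vbasisP C).
Qed.

Lemma fiber_shiftD U U' :
  fiber_shift (U + U') = fiber_shift U + fiber_shift U'.
Proof. by rewrite /fiber_shift mulmxDl raddfD. Qed.

Lemma shift_morphM : {in [set: 'rV['Z_2]_(n * \dim C)] &,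
  {morph (fun x => skew 1%g (fiber_shift (vec_mx x)) 1%g) : x y / (x * y)%g}}.
Proof.
move=> x y _ _; rewrite skewM mulg1 mulmx1 row_perm1 mulg1.
by rewrite FinRing.zmodMgE linearD fiber_shiftD.
Qed.

Lemma base_morphM : {in code_aut C &,
  {morph (fun t => skew t 0 1%g) : t t' / (t * t')%g}}.
Proof.
by move=> t t' _ _; rewrite skewM mulg1 mul0mx add0r row_permE mulmx0.
Qed.

Lemma linear_morphM : {in 'GL_n(2) &,
  {morph (fun u => skew 1%g 0 u) : u u' / (u * u')%g}}.
Proof.
by move=> u u' _ _; rewrite skewM mulg1 mul0mx add0r row_permE mulmx0.
Qed.

Lemma cols_in_mul W (M : 'M_n) : cols_in C W -> cols_in C (W *m M).
Proof.
move=> WC i; rewrite tr_col trmx_mul row_mul mulmx_sum_row.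
by apply: memv_suml => l _; rewrite memvZ // -tr_col.
Qed.

Lemma cols_in_perm t W :
  t \in code_aut C -> cols_in C W -> cols_in C (row_perm t W).
Proof.
move=> /code_autP tC WC i.
have -> : (col i (row_perm t W))^T = col_perm t (col i W)^T.
  by apply/rowP=> a; rewrite !mxE.
exact: tC.
Qed.

Theorem skew_aut_structure : exists A B G T : {group 'S_N},
  [/\ (A ><| B)%g = code_aut D, A \isog [set: 'rV['Z_2]_(n * \dim C)],
      (G \x T)%g = B, G \isog 'GL_n(2) & T \isog code_aut C].
Proof.
pose fA := Morphism shift_morphM; pose fG := Morphism linear_morphM.
pose fT := Morphism base_morphM.
pose A := (fA @* setT)%G; pose G := (fG @* 'GL_n(2))%G.
pose T := (fT @* code_aut C)%G.
have cols_in0 : cols_in C 0 by move=> i; rewrite col0 trmx0 mem0v.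
have row_perm0 t : row_perm t 0 = 0 :> 'M['F_2]_(N', n).
  by rewrite row_permE mulmx0.
have AP s : reflect (exists2 W, cols_in C W & s = skew 1%g W 1%g) (s \in A).
  apply: (iffP morphimP) => [[x _ _ ->] | [W /fiber_shift_onto[U ->] ->]].
    by exists (fiber_shift (vec_mx x)) => //; apply: fiber_shift_in.
  by exists (mxvec U); rewrite ?inE //= mxvecK.
have GP s : reflect (exists u, s = skew 1%g 0 u) (s \in G).
  apply: (iffP morphimP) => [[u _ _ ->] | [u ->]]; first by exists u.
  by exists u; rewrite ?inE.
have TP s :
    reflect (exists2 t, t \in code_aut C & s = skew t 0 1%g) (s \in T).
  apply: (iffP morphimP) => [[t _ tC ->] | [t tC ->]]; first by exists t.
  by exists t.
have cGT : T \subset 'C(G)%g.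
  apply/centsP=> _ /TP[t tC ->] _ /GP[u ->].
  by rewrite /commute !skewM !mul0mx !row_perm0 !addr0 !mulg1 !mul1g.
have BP s : reflect (exists u, exists2 t, t \in code_aut C & s = skew t 0 u)
    (s \in G <*> T)%g.
  rewrite cent_joinEr //.
  apply: (iffP mulsgP) => [[_ _ /GP[u ->] /TP[t tC ->] ->] | [u [t tC ->]]].
    by exists u, t; rewrite // skewM mul0mx row_perm0 addr0 mulg1 mul1g.
  exists (skew 1%g 0 u) (skew t 0 1%g); first by apply/GP; exists u.
    by apply/TP; exists t.
  by rewrite skewM mul0mx row_perm0 addr0 mulg1 mul1g.
have tiGT : (G :&: T = 1)%g.
  apply/trivgP/subsetP=> _ /setIP[/GP[u ->] /TP[t _ /skew_eq[_ _ ->]]].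
  by rewrite skew1 inE.
(* From skewM, (t, 0, u)^-1 (1, W, 1) (t, 0, u) = (1, W', 1), where W' is W u
   with its rows permuted by t^-1. *)
have nAB : (G <*> T \subset 'N(A))%g.
  apply/subsetP=> _ /BP[u [t tC ->]]; rewrite inE.
  apply/subsetP=> _ /imsetP[_ /AP[W WC ->] ->]; apply/AP.
  exists (row_perm t^-1%g (W *m GLval u)).
    by apply: cols_in_perm; rewrite ?groupV //; apply: cols_in_mul.
  apply: (mulgI (skew t 0 u)); rewrite -conjgC !skewM mulmx1 -row_permM mulgV.
  by rewrite row_perm0 row_perm1 addr0 add0r mulg1 mul1g mulg1 mul1g.
have tiAB : (A :&: (G <*> T) = 1)%g.
  apply/trivgP/subsetP=> _ /setIP[/AP[W _ ->] /BP[u [t _ /skew_eq[_ -> _]]]].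
  by rewrite skew1 inE.
exists A, (G <*> T)%G, G, T; split.
- rewrite sdprodE //; apply/eqP; rewrite eqEsubset; apply/andP; split.
    apply/subsetP=> _ /mulsgP[_ _ /AP[W WC ->] /BP[u [t tC ->]] ->].
    by rewrite groupM ?skew_aut ?group1.
  apply/subsetP=> _ /aut_skew[t [W [u [tC WC ->]]]]; apply/mulsgP.
  (* The factor (t, 0, u) on the right multiplies the translation part by u. *)
  exists (skew 1%g (W *m GLval u^-1) 1%g) (skew t 0 u).
  - by apply/AP; exists (W *m GLval u^-1); first apply: cols_in_mul.
  - by apply/BP; exists u, t.
  rewrite skewM row_perm0 addr0 !mul1g -mulmxA GL_VxE mulVmx ?mulmx1 //.
  exact: (GL_unitmx u).
- rewrite isog_sym; apply: sub_isog => //.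
  apply/injmP=> x y _ _ /skew_eq[_ /fiber_shift_inj eq_xy _].
  by rewrite -(vec_mxK x) eq_xy vec_mxK.
- exact: dprodEY.
- rewrite isog_sym; apply: sub_isog => //.
  by apply/injmP=> u u' _ _ /skew_eq[].
- rewrite isog_sym; apply: sub_isog => //.
  by apply/injmP=> t t' _ _ /skew_eq[].
Qed.

End SkewProduct.

(** * Binary digits and evaluation of monomials *)

Lemma F2_natr_bool (x : 'F_2) : x = (x != 0)%:R.
Proof. by apply/val_inj; case: x => [[|[|]]]. Qed.

Lemma digit_inj m (j j' : nat) : (j < 2 ^ m)%N -> (j' < 2 ^ m)%N ->
  (forall i, (i < m)%N -> digit i j = digit i j') -> j = j'.
Proof.
elim: m j j' => [|m IHm] j j'; first by rewrite !ltnS !leqn0 => /eqP-> /eqP->.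
move=> lt_j lt_j' eq_d; rewrite -(odd_double_half j) -(odd_double_half j').
have := eq_d 0%N isT; rewrite /digit expn0 !divn1 => ->; congr (_ + _.*2)%N.
apply: IHm => [||i lt_i]; rewrite ?ltn_half_double -?mul2n -?expnS //.
by have := eq_d i.+1 lt_i; rewrite /digit expnS !divnMA !divn2.
Qed.

Lemma digit_ord_inj m (j j' : 'I_(2 ^ m)) :
  (forall i : 'I_m, digit i j = digit i j') -> j = j'.
Proof.
move=> eq_d; apply/val_inj/(digit_inj (ltn_ord j) (ltn_ord j')) => i lt_i.
exact: (eq_d (Ordinal lt_i)).
Qed.

(** As there are 2 ^ m positions and 2 ^ m digit sequences, the injectivity of
    the digits suffices. *)
Lemma digit_onto m (d : 'I_m -> bool) :
  exists j : 'I_(2 ^ m), forall i : 'I_m, digit i j = d i.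
Proof.
pose dig (j : 'I_(2 ^ m)) := [ffun i : 'I_m => digit i j].
have dig_inj : injective dig.
  move=> j j' /ffunP eq_d; apply: digit_ord_inj => i.
  by have := eq_d i; rewrite !ffunE.
have [|g _ gK] := inj_card_bij dig_inj.
  by rewrite card_ffun card_bool !card_ord.
exists (g [ffun i => d i]) => i.
by rewrite -[d i]ffunE -[in RHS](gK (finfun _)) ffunE.
Qed.

Lemma digit_mod k i j : (i < k)%N -> digit i (j %% 2 ^ k) = digit i j.
Proof.
move=> lt_ik; rewrite /digit -{1}(subnK (ltnW lt_ik)) expnD -modn_divl.
by rewrite odd_mod // oddX subn_eq0 leqNgt lt_ik.
Qed.

Lemma exists_flip m (i : 'I_m) :
  exists phi : 'I_(2 ^ m) -> 'I_(2 ^ m), injective phi /\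
    forall j (l : 'I_m), digit l (phi j) = digit l j (+) (l == i).
Proof.
have [phi phiP] := fin_all_exists (fun j : 'I_(2 ^ m) =>
  digit_onto (fun l : 'I_m => digit l j (+) (l == i))).
exists phi; split=> // j j' eq_phi; apply: digit_ord_inj => l.
by apply: (@addIb (l == i)); rewrite -!phiP eq_phi.
Qed.

Lemma evalE m (f : monomial m) j :
  eval f 0 j = [forall i in f, ~~ digit i j]%:R.
Proof.
rewrite mxE; case: forall_inP => [all1 | /forall_inP].
  by apply: big1 => i /all1; rewrite mxE => ->.
rewrite negb_forall_in => /exists_inP[i fi /negPn di].
by rewrite (bigD1 i) //= mxE di mul0r.
Qed.

Lemma eval_neq0 m (f : monomial m) j :
  (eval f 0 j != 0) = [forall i in f, ~~ digit i j].
Proof. by rewrite evalE; case: [forall i in f, _]. Qed.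

Lemma eval1E m (i : 'I_m) j : eval [set i] 0 j = (~~ digit i j)%:R.
Proof. by rewrite mxE big_set1 mxE. Qed.

Lemma eval_in m (M : {set monomial m}) f :
  f \in M -> eval f \in monomial_code M.
Proof. by move=> Mf; apply: memv_span; apply: map_f; rewrite mem_enum. Qed.

Lemma monomial_code_sub m (M : {set monomial m})
    (V : {vspace 'rV['F_2]_(2 ^ m)}) :
  (forall f, f \in M -> eval f \in V) -> (monomial_code M <= V)%VS.
Proof.
move=> MV; apply/span_subvP=> _ /mapP[f Mf ->].
by apply: MV; rewrite -mem_enum.
Qed.

(** * Balanced words *)

Definition supp N (c : 'rV['F_2]_N) : {set 'I_N} := [set j | c 0 j != 0].

Definition balanced N (c : 'rV['F_2]_N) : bool := #|~: supp c| == #|supp c|.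

Lemma balanced_perm N (s : 'S_N) (c : 'rV['F_2]_N) :
  balanced (col_perm s c) = balanced c.
Proof.
have supp_s : supp (col_perm s c) = s @^-1: supp c.
  by apply/setP=> j; rewrite !inE mxE.
by rewrite /balanced supp_s -preimsetC !card_preimset //; apply: perm_inj.
Qed.

Lemma card_swap (T : finType) (phi : T -> T) (A : {set T}) :
  injective phi -> (forall x, (phi x \in A) = (x \notin A)) -> #|~: A| = #|A|.
Proof.
move=> phi_inj phiP; rewrite -(card_preimset A phi_inj).
by apply: eq_card => x; rewrite !inE phiP.
Qed.

(** The variable x_i is balanced, so a word supported properly inside the
    support of x_i has weight less than half of the length. *)
Lemma unbalanced_below m (i : 'I_m) (c : 'rV['F_2]_(2 ^ m))
    (j0 : 'I_(2 ^ m)) :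
    (forall j, c 0 j != 0 -> ~~ digit i j) -> ~~ digit i j0 -> c 0 j0 = 0 ->
  ~~ balanced c.
Proof.
move=> supp_c i_j0 c_j0; have [phi [phi_inj phiP]] := exists_flip i.
pose X := [set j : 'I_(2 ^ m) | ~~ digit i j].
have half : #|~: X| = #|X|.
  by apply: card_swap phi_inj _ => j; rewrite !inE phiP eqxx addbT.
have ltSX : supp c \proper X.
  apply/properP; split; last by exists j0; rewrite inE // c_j0 eqxx.
  by apply/subsetP=> j /[!inE]; apply: supp_c.
rewrite neq_ltn orbC (leq_trans (proper_card ltSX)) // -half.
by rewrite subset_leq_card // setCS proper_sub.
Qed.

Lemma unbalanced_one m : ~~ balanced (eval (set0 : monomial m)).
Proof.
rewrite /balanced; have -> : supp (eval (set0 : monomial m)) = setT.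
  by apply/setP=> j; rewrite !inE eval_neq0; apply/forall_inP=> i; rewrite inE.
by rewrite setCT cards0 cardsT card_ord eq_sym expn_eq0.
Qed.

Lemma digit0 i : digit i 0 = false.
Proof. by rewrite /digit div0n. Qed.

Lemma unbalanced_deg2 m (f : monomial m) : (1 < #|f|)%N -> ~~ balanced (eval f).
Proof.
case/card_gt1P=> i [i' [fi fi' neq_ii']].
(* A position where x_i = 1 and x_i' = 0. *)
have [j0 j0P] := digit_onto (fun l => l == i').
apply: (@unbalanced_below _ i _ j0).
- by move=> j; rewrite eval_neq0 => /forall_inP; apply.
- by rewrite j0P.
rewrite evalE; case: forall_inP => // /(_ _ fi').
by rewrite j0P eqxx.
Qed.

(** The word is x_i (1 + x_i'): its support is properly contained in that of
    x_i, since it vanishes at position 0, where all variables are 1. *)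
Lemma unbalanced_var_add m (i i' : 'I_m) :
  ~~ balanced (eval [set i] + eval [set i; i']).
Proof.
pose j0 : 'I_(2 ^ m) := Ordinal (expn_gt0 2 m).
apply: (@unbalanced_below _ i _ j0).
- move=> j; rewrite mxE eval1E evalE; apply: contra => di.
  by rewrite di; case: forall_inP => // /(_ i); rewrite di set21 => /(_ isT).
- by rewrite digit0.
rewrite mxE eval1E evalE digit0; case: forall_inP => [_|[]].
  by apply/val_inj.
by move=> l _; rewrite digit0.
Qed.

(** * Splitting a position into low and high digits *)

Section Split.

Context (k n' : nat).
Local Notation n := n'.+1.
Local Notation m := (k + n)%N.

Definition low (j : 'I_(2 ^ m)) : 'I_(2 ^ k) :=
  Ordinal (ltn_pmod j (expn_gt0 2 k)).

Definition high (j : 'I_(2 ^ m)) : 'rV['F_2]_n :=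
  \row_i eval_var (rshift k i) 0 j.

Lemma digit_low (j : 'I_(2 ^ m)) i : (i < k)%N -> digit i (low j) = digit i j.
Proof. exact: digit_mod. Qed.

Lemma highE j i : high j 0 i = (~~ digit (k + i) j)%:R.
Proof. by rewrite !mxE. Qed.

Lemma low_high_inj j j' : low j = low j' -> high j = high j' -> j = j'.
Proof.
move=> eq_lo eq_hi; apply: digit_ord_inj => l; case: (split_ordP l) => i ->.
  have lt_ik := ltn_ord i; rewrite /=.
  by rewrite -[LHS]digit_low // eq_lo digit_low.
move/rowP/(_ i): eq_hi; rewrite !highE.
by case: (digit _ j); case: (digit _ j').
Qed.

Lemma position_split :
  exists pos : 'I_(2 ^ k) -> 'rV['F_2]_n -> 'I_(2 ^ m),
    [/\ forall a b, low (pos a b) = a, forall a b, high (pos a b) = b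
      & forall j, pos (low j) (high j) = j].
Proof.
have split_onto (ab : 'I_(2 ^ k) * 'rV['F_2]_n) :
    exists j, low j = ab.1 /\ high j = ab.2.
  case: ab => a b; pose d (l : 'I_m) :=
    match fintype.split l with inl i => digit i a | inr i => b 0 i == 0 end.
  have [j dj] := digit_onto d; exists j; split.
    apply: digit_ord_inj => i; rewrite digit_low //.
    by rewrite -[i : nat]/(lshift n i : nat) dj /d (unsplitK (inl i)).
  apply/rowP=> i; rewrite highE -[(k + i)%N]/(rshift k i : nat) dj /d.
  by rewrite (unsplitK (inr i)) -F2_natr_bool.
have [pos posP] := fin_all_exists split_onto.
exists (fun a b => pos (a, b)); split=> [a b|a b|j].
- by case: (posP (a, b)).
- by case: (posP (a, b)).
by have [] := posP (low j, high j); apply: low_high_inj.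
Qed.

Definition pullback_mx : 'M['F_2]_(2 ^ k, 2 ^ m) :=
  \matrix_(a, j) (a == low j)%:R.

Lemma pullback_mxE (f : 'rV_(2 ^ k)) j : (f *m pullback_mx) 0 j = f 0 (low j).
Proof.
rewrite mxE (bigD1 (low j)) //= mxE eqxx mulr1 big1 ?addr0 // => a.
by rewrite mxE => /negPf->; rewrite mulr0.
Qed.

Definition pullback : 'Hom('rV['F_2]_(2 ^ k), 'rV['F_2]_(2 ^ m)) :=
  linfun (mulmxr pullback_mx).

Lemma pullbackE f j : pullback f 0 j = f 0 (low j).
Proof. by rewrite lfunE /= pullback_mxE. Qed.

Lemma eval_low (lekm : (k <= m)%N) (f : monomial k) :
  eval (widen_mon lekm f) = pullback (eval f).
Proof.
apply/rowP=> j; rewrite pullbackE !evalE; congr (nat_of_bool _)%:R.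
apply/forall_inP/forall_inP => [fP i fi | fP _ /imsetP[i fi ->] /=].
  by rewrite digit_low //; apply: (fP (widen_ord lekm i)); apply: imset_f.
by rewrite -(digit_low j) // fP.
Qed.

Section Codes.

Context (lekm : (k <= m)%N) (M : {set monomial m}).
Hypothesis M_low : forall f, f \in M -> forall i, i \in f -> (i < k)%N.

Lemma widen_mon_onto f : f \in M ->
  exists2 g, g \in regard lekm M & f = widen_mon lekm g.
Proof.
move=> Mf; have Ef : f = widen_mon lekm [set i | widen_ord lekm i \in f].
  apply/setP=> i; apply/idP/imsetP => [fi | [l /[!inE] fl ->] //].
  have lt_ik := M_low Mf fi.
  have Ei : i = widen_ord lekm (Ordinal lt_ik) by apply: val_inj.
  by exists (Ordinal lt_ik); rewrite // inE -Ei.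
by exists [set i | widen_ord lekm i \in f]; rewrite // inE -Ef.
Qed.

Lemma monomial_code_low :
  monomial_code M = (pullback @: monomial_code (regard lekm M))%VS.
Proof.
rewrite limg_span; apply: eq_span => c.
apply/mapP/mapP => [[f + ->] | [_ /mapP[g + ->] ->]]; rewrite mem_enum.
  case/widen_mon_onto=> g Mg ->.
  by exists (eval g); rewrite ?eval_low // map_f // mem_enum.
rewrite inE => Mg; exists (widen_mon lekm g); last by rewrite eval_low.
by rewrite mem_enum.
Qed.

Lemma dim_monomial_code_low :
  \dim (monomial_code M) = \dim (monomial_code (regard lekm M)).
Proof.
have [pos [lo_pos _ _]] := position_split.
rewrite monomial_code_low limg_dim_eq //.
suff -> : lker pullback = 0%VS by rewrite capv0.
apply/eqP/lker0P=> f g /rowP eq_fg; apply/rowP=> a.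
by have := eq_fg (pos a 0); rewrite !pullbackE lo_pos.
Qed.

Context (E : {set monomial m}).
Hypothesis EP : forall f,
  (f \in E) = (f \in M) || [exists i : 'I_n, f == [set rshift k i]].

Lemma monomial_code_split c :
  c \in monomial_code E <->
  exists2 f, f \in monomial_code (regard lekm M) &
    exists lam, c = word low high f lam.
Proof.
pose H : 'Hom('cV['F_2]_n, 'rV['F_2]_(2 ^ m)) :=
  linfun (trmx \o mulmx (\matrix_j high j)).
have HE lam j : H lam 0 j = (high j *m lam) 0 0.
  by rewrite lfunE /= !mxE; apply: eq_bigr => i _; rewrite mxE.
have eval_high i : eval [set rshift k i] = H (delta_mx i 0).
  by apply/rowP=> j; rewrite HE -colE eval1E [RHS]mxE highE.
have -> : monomial_code E = (monomial_code M + limg H)%VS.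
  apply/subv_anti/andP; split.
    apply: monomial_code_sub => f; rewrite EP => /orP[Mf | /existsP[i /eqP->]].
      by apply: subvP (addvSl _ _) _ _; apply: eval_in.
    rewrite eval_high; apply: subvP (addvSr _ _) _ _.
    by apply: memv_img; rewrite memvf.
  apply/subvP=> _ /memv_addP[a aM [_ /memv_imgP[lam _ ->] ->]]; apply: memvD.
    move: a aM; apply/subvP/monomial_code_sub => f Mf.
    by apply: eval_in; rewrite EP Mf.
  have -> : lam = \sum_i lam i 0 *: delta_mx i 0.
    rewrite [lam in LHS]matrix_sum_delta; apply: eq_bigr => i _.
    by rewrite big_ord1.
  rewrite linear_sum memv_suml // => i _.
  rewrite linearZ /= memvZ // -eval_high.
  by apply: eval_in; rewrite EP orbC; apply/orP; left; apply/existsP; exists i.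
rewrite monomial_code_low; split.
  case/memv_addP=> _ /memv_imgP[f fC ->] [_ /memv_imgP[lam _ ->] ->].
  by exists f => //; exists lam; apply/rowP=> j; rewrite wordE mxE pullbackE HE.
case=> f fC [lam ->]; apply/memv_addP.
exists (pullback f); first exact: memv_img.
exists (H lam); first by apply: memv_img; rewrite memvf.
by apply/rowP=> j; rewrite wordE [RHS]mxE pullbackE HE.
Qed.

(** If lam_i is nonzero, flipping the digit k + i keeps the low part and changes
    the value of the word everywhere. *)
Lemma balanced_word f lam : lam != 0 -> balanced (word low high f lam).
Proof.
move=> lam_neq0; have [i lam_i] : exists i, lam i 0 != 0.
  apply/existsP; apply: contraNT lam_neq0; rewrite negb_exists => /forallP lam0.
  by apply/eqP/colP=> i; rewrite [RHS]mxE; apply/eqP; rewrite -[_ == _]negbK.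
have [phi [phi_inj phiP]] := exists_flip (rshift k i).
apply/eqP; apply: card_swap phi_inj _ => j.
have lo_phi : low (phi j) = low j.
  apply: digit_ord_inj => l; rewrite !digit_low //.
  by rewrite -[l : nat]/(lshift n l : nat) phiP eq_lrshift addbF.
have hi_phi : high (phi j) = high j + delta_mx 0 i.
  apply/rowP=> l; rewrite [RHS]mxE [delta_mx _ _ _ _]mxE !highE.
  rewrite -[(k + l)%N]/(rshift k l : nat) phiP eq_rshift eqxx /=.
  by case: (l == i); case: (digit _ j); apply/val_inj.
rewrite !inE !wordE lo_phi hi_phi mulmxDl mxE addrA -rowE [row _ _ _ _]mxE.
move: lam_i; rewrite -!/(_ != 0); move: (f 0 _ + _) (lam i 0).
by case=> [[|[|]]] // ? [[|[|]]].
Qed.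

End Codes.
End Split.

(** * The generating monomials *)

Lemma enum_set2 m (a b : 'I_m) : (a < b)%N -> enum [set a; b] = [:: a; b].
Proof.
move=> lt_ab; apply: (@irr_sorted_eq _ (relpre val ltn)).
- by move=> i j l; apply: ltn_trans.
- by move=> i; apply: ltnn.
- rewrite -sorted_map; have : sorted ltn [seq val i | i <- enum 'I_m].
    by rewrite val_enum_ord iota_ltn_sorted.
  rewrite !sorted_map /enum_mem => /sorted_filter; apply.
  by move=> i j l; apply: ltn_trans.
- by rewrite /= lt_ab.
by move=> i; rewrite mem_enum !inE.
Qed.

Section Generators.

Context (k m : nat) (S : {set monomial m}).
Hypothesis S_deg : forall f, f \in S -> (1 < #|f|)%N.

Lemma gens_kE f : (f \in gens_k k S) =
  [|| f == set0, [exists i : 'I_m, (i < k)%N && (f == [set i])] | f \in S].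
Proof.
rewrite /gens_k /gens_m !inE.
have [-> | f_neq0] := eqVneq f set0.
  rewrite andbT; apply/imsetP=> -[i _ /setP/(_ i)].
  by rewrite set11 inE.
case: (boolP (f \in S)) => /= [fS | _].
  rewrite !orbT andbT; apply/imsetP=> -[i _ Ef].
  by have := S_deg fS; rewrite Ef cards1.
rewrite !orbF; apply/andP/existsP.
  case=> f_low /imsetP[i _ Ef]; exists i; rewrite Ef eqxx andbT ltnNge.
  by apply: contra f_low => le_ki; apply/imsetP; exists i; rewrite ?inE.
case=> i /andP[lt_ik /eqP->]; split; last exact: imset_f.
apply/imsetP=> -[l /[!inE] le_kl /set1_inj eq_il].
by rewrite leqNgt -eq_il lt_ik in le_kl.
Qed.

Lemma gens_m_split f :
  (f \in gens_m S) = (f \in gens_k k S)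
    || [exists i : 'I_m, (k <= i)%N && (f == [set i])].
Proof.
rewrite gens_kE !inE -!orbA; case: eqP => //= _; rewrite orbC.
case: (f \in S) => //=; rewrite ?orbT //.
apply/imsetP/orP.
  case=> i _ ->; case: (ltnP i k) => ik; [left | right]; apply/existsP;
    by exists i; rewrite ik eqxx.
by case=> /existsP[i /andP[_ /eqP->]]; exists i.
Qed.

Hypothesis S_x0xk1 :
  [set i : 'I_m | (i == 0 :> nat) || (i == k.-1 :> nat)] \in S.
Hypothesis S_decr : decreasing (gens_m S).
Hypothesis k_ge2 : (2 <= k)%N.
Hypothesis k_le_m : (k <= m)%N.

(** The monomial x_0 x_i is below x_0 x_(k-1), and the only generators of degree
    2 are in S. *)
Lemma x0xi_in_S (i0 i : 'I_m) :
  i0 = 0 :> nat -> (0 < i < k)%N -> [set i0; i] \in S.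
Proof.
move=> i0_0 /andP[i_gt0 i_ltk].
have lt_k1 : (k.-1 < m)%N by rewrite prednK // (ltn_trans _ k_ge2).
pose l := Ordinal lt_k1.
have lt_0i : (i0 < i)%N by rewrite i0_0.
have lt_0l : (i0 < l)%N by rewrite i0_0 /= -ltnS prednK // (ltn_trans _ k_ge2).
have: [set i0; i] \in gens_m S.
  apply: (S_decr (g := [set i0; l])).
    rewrite !inE; apply/orP; right; apply/orP; right.
    move: S_x0xk1; congr (_ \in S); apply/setP=> j; rewrite !inE.
    by rewrite -!val_eqE /= i0_0.
  apply/existsP; exists [set i0; l]; rewrite subxx !cards2.
  rewrite !neq_ltn lt_0i lt_0l eqxx /eqdeg_le !enum_set2 //= leqnn /= andbT.
  by rewrite -ltnS prednK // (ltn_trans _ k_ge2).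
rewrite !inE => /or3P[/eqP/setP/(_ i0) | /imsetP[j _ Ej] | //].
  by rewrite set21 inE.
by have := cards1 j; rewrite -Ej cards2 neq_ltn lt_0i.
Qed.

(** The partner of x_i is x_0, except for x_0 whose partner is x_1; this needs
    k to be at least 2. *)
Lemma low_var_partner (i : 'I_m) : (i < k)%N -> exists i', [set i; i'] \in S.
Proof.
move=> lt_ik; have m_gt1 := leq_trans k_ge2 k_le_m.
pose i0 := Ordinal (ltnW m_gt1); pose i1 := Ordinal m_gt1.
case: (posnP i) => [i_0 | i_gt0].
  by exists i1; apply: x0xi_in_S.
by exists i0; rewrite setUC; apply: x0xi_in_S => //; rewrite i_gt0.
Qed.

End Generators.

(** * The automorphism group *)

Section AutGroup.

Context (k n' : nat).
Local Notation n := n'.+1.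
Local Notation m := (k + n)%N.
Context (lekm : (k <= m)%N) (S : {set monomial m}).
Hypothesis S_deg : forall f, f \in S -> (1 < #|f|)%N.
Hypothesis S_vars : forall f, f \in S -> forall i : 'I_m, i \in f -> (i < k)%N.
Hypothesis S_partner :
  forall i : 'I_m, (i < k)%N -> exists i', [set i; i'] \in S.

Lemma gens_k_low f : f \in gens_k k S -> forall i : 'I_m, i \in f -> (i < k)%N.
Proof.
rewrite gens_kE // => /or3P[/eqP-> | /existsP[l /andP[lt_lk /eqP->]] | fS] i.
- by rewrite inE.
- by rewrite inE => /eqP->.
exact: S_vars fS i.
Qed.

Lemma gens_m_high f : (f \in gens_m S) =
  (f \in gens_k k S) || [exists i : 'I_n, f == [set rshift k i]].
Proof.
rewrite (gens_m_split k) //; congr (_ || _); apply/existsP/existsP.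
  case=> i /andP[le_ki /eqP->]; case: (split_ordP i) le_ki => l -> /=.
    by rewrite leqNgt ltn_ord.
  by exists l.
by case=> i /eqP->; exists (rshift k i); rewrite eqxx leq_addr.
Qed.

Lemma unbalanced_low c : c \in monomial_code (gens_m S) -> ~~ balanced c ->
  c \in monomial_code (gens_k k S).
Proof.
case/(monomial_code_split lekm gens_k_low gens_m_high) => f fC [lam ->] unbal.
rewrite (monomial_code_low lekm gens_k_low).
have lam0 : lam = 0 by apply: contraNeq unbal; apply: balanced_word.
suff -> : word (@low k n') (@high k n') f lam = pullback k n' f.
  exact: memv_img.
by apply/rowP=> j; rewrite wordE lam0 mulmx0 pullbackE [X in _ + X]mxE addr0.
Qed.

(** Each generator of the subcode is a sum of unbalanced words of the large
    code, and a permutation maps these to unbalanced words, which lie in the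
    subcode again. *)
Lemma aut_sub :
  code_aut (monomial_code (gens_m S))
    \subset code_aut (monomial_code (gens_k k S)).
Proof.
apply/subsetP=> s /code_autP s_aut; apply/code_autP.
pose P := linfun (col_perm s : 'rV['F_2]_(2 ^ m) -> 'rV['F_2]_(2 ^ m)).
have PE c : P c = col_perm s c by rewrite lfunE.
have subCm f : f \in gens_k k S -> eval f \in monomial_code (gens_m S).
  by move=> fM; apply: eval_in; rewrite gens_m_high fM.
have unb c : c \in monomial_code (gens_m S) -> ~~ balanced c ->
    P c \in monomial_code (gens_k k S).
  by move=> cC unbal; rewrite PE unbalanced_low ?s_aut ?balanced_perm.
pose Ck := monomial_code (gens_k k S).
suff sub : (Ck <= P @^-1: Ck)%VS.
  by move=> c /(subvP sub); rewrite -memv_preim PE.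
apply: monomial_code_sub => f fM; rewrite -memv_preim.
have fCm := subCm f fM.
move: (fM); rewrite gens_kE //.
case/or3P=> [/eqP f0 | /existsP[i /andP[lt_ik /eqP Ef]] | fS].
- by apply: unb => //; rewrite f0 unbalanced_one.
(* Here x_i = (x_i + x_i x_i') - x_i x_i'. *)
- have [i' iS] := S_partner lt_ik.
  have pM : [set i; i'] \in gens_k k S by rewrite gens_kE // iS !orbT.
  rewrite -[eval f](addrK (eval [set i; i'])) linearB; apply: memvB.
    by rewrite unb ?memvD ?subCm // Ef unbalanced_var_add.
  by rewrite unb ?subCm // unbalanced_deg2 // S_deg.
by rewrite unb // unbalanced_deg2 // S_deg.
Qed.

Lemma regard_separates a a' :
  (forall f, f \in monomial_code (regard lekm (gens_k k S)) ->
     f 0 a = f 0 a') -> a = a'.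
Proof.
move=> eq_f; apply: digit_ord_inj => i.
have := eq_f (eval [set i]); rewrite !eval1E => eq_i; apply/negb_inj.
have /eq_i : eval [set i] \in monomial_code (regard lekm (gens_k k S)).
  apply: eval_in; rewrite inE gens_kE //; apply/or3P/Or32/existsP.
  by exists (widen_ord lekm i); rewrite /= ltn_ord /widen_mon imset_set1 eqxx.
by case: (digit i a); case: (digit i a').
Qed.

Lemma aut_structure :
  let C := monomial_code (regard lekm (gens_k k S)) in
  exists A B G T : {group 'S_(2 ^ m)},
    [/\ (A ><| B)%g = code_aut (monomial_code (gens_m S)),
        A \isog [set: 'rV['Z_2]_(n * \dim C)],
        (G \x T)%g = B, G \isog 'GL_n(2) & T \isog code_aut C].
Proof.
have [pos [lo_pos hi_pos posK]] := position_split k n'.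
apply: (skew_aut_structure (Ordinal (expn_gt0 2 k)) lo_pos hi_pos posK).
- move=> c; apply: monomial_code_split => f; last exact: gens_m_high.
  exact: gens_k_low.
- exact: regard_separates.
move=> s /(subsetP aut_sub)/code_autP s_aut f fC.
have := s_aut (pullback k n' f).
rewrite (monomial_code_low lekm gens_k_low) => /(_ (memv_img _ fC)).
case/memv_imgP=> f' f'C /rowP Ef; exists f' => // j.
by have := Ef j; rewrite mxE !pullbackE.
Qed.

End AutGroup.

Local Open Scope group_scope.

Theorem theorem3p6 (m k : nat) (k_ge2 : (2 <= k)%N) (k_lt_m : (k < m)%N)
    (S : {set monomial m})
    (S_deg : forall f, f \in S -> (1 < #|f|)%N)
    (S_vars : forall f, f \in S -> forall i : 'I_m, i \in f -> (i < k)%N)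
    (S_x0xk1 : [set i : 'I_m | (i == 0 :> nat) || (i == k.-1 :> nat)] \in S)
    (Cm : {vspace 'rV['F_2]_(2 ^ m)}) (Cm_polar : polar_code (gens_m S) Cm) :
  let Ck := monomial_code (gens_k k S) in
  let K := \dim Ck in
  let barCk := monomial_code (regard (ltnW k_lt_m) (gens_k k S)) in
  code_aut Cm \subset code_aut Ck
  /\ exists A B G T : {group 'S_(2 ^ m)},
       [/\ A ><| B = code_aut Cm,
           A \isog [set: 'rV['Z_2]_((m - k) * K)],
           G \x T = B,
           G \isog 'GL_(m - k)(2)
         & T \isog code_aut barCk].
Proof.
case: Cm_polar => _ -> S_decr Ck K barCk.
have S_partner (i : 'I_m) : (i < k)%N -> exists i', [set i; i'] \in S.
  exact: low_var_partner S_x0xk1 S_decr k_ge2 (ltnW k_lt_m) i.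
have [n' Em] : exists n', m = (k + n'.+1)%N.
  by exists (m - k.+1)%N; rewrite addnS -addSn subnKC.
clear Cm S_decr S_x0xk1; subst m; split.
  exact (aut_sub (ltnW k_lt_m) S_deg S_vars S_partner).
rewrite addKn /K /Ck (dim_monomial_code_low (ltnW k_lt_m)); last first.
  exact: gens_k_low S_deg S_vars.
exact: aut_structure S_deg S_vars S_partner.
Qed.
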